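(* Let $1\le p,q\le\infty$, let $u,v$ be weights, and consider the integral transform $Tf(y)=\int_0^\infty f(x)K(x,y)\,dx$, $y>0$. Let $\varphi:(0,\infty)\to(0,\infty)$ be a $C^1$ bijective function, and let $s_1,s_2,w_1,w_2$ be nonnegative functions on $(0,\infty)$. Assume that the weighted norm inequality $\|Tf\|_{L_q^u}\le C\|f\|_{L_p^v}$ holds for every $f\in L_p^v$, with a constant $C>0$ independent of $f$ (in particular $Tf$ is defined, in the sense specified in the context, for every $f\in L_p^v$). (1) If there is $c_1>0$ such that $K(x,y)\ge c_1 s_1(x)w_1(y)$ for all $y>0$ and $x\in(0,\varphi(y))$, and $s_1v^{-1}\in L_{p'}(0,r)$ for every $r>0$, then $$\sup_{r>0}\|w_1u\|_{L_q(\varphi^{-1}(r,\infty))}\,\|s_1v^{-1}\|_{L_{p'}(0,r)}<\infty.$$ (2) If there is $c_2>0$ such that $K(x,y)\ge c_2 s_2(x)w_2(y)$ for all $y>0$ and $x\in(\varphi(y),\infty)$, and $s_2v^{-1}\in L_{p'}(r,\infty)$ for every $r>0$, then $$\sup_{r>0}\|w_2u\|_{L_q(\varphi^{-1}(0,r))}\,\|s_2v^{-1}\|_{L_{p'}(r,\infty)}<\infty.$$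
   Context: A weight is a positive locally integrable function on $\mathbb{R}_+=(0,\infty)$. For $1\le p\le\infty$, $p'$ is the Hölder conjugate ($\frac1p+\frac1{p'}=1$). For a measurable set $E\subset\mathbb{R}_+$, $\|f\|_{L_p(E)}=(\int_E|f|^p\,dx)^{1/p}$, and $\|f\|_{L_p^v}=\left(\int_0^\infty v(x)^p|f(x)|^p\,dx\right)^{1/p}$, with the obvious modification for $p=\infty$ (i.e. $\|f\|_{L_\infty^v}=\operatorname{ess\,sup} v|f|$); $L_p^v$ is the space of measurable $f$ with $\|f\|_{L_p^v}<\infty$. A function is locally integrable if it is integrable on every compact subset of $\mathbb{R}_+$. $\varphi^{-1}(a,b)$ denotes the image of the interval $(a,b)$ under $\varphi^{-1}$. All functions involved (including $K$) are measurable, and $0\cdot\infty$ is read as $0$. $Tf$ is defined when $x\mapsto f(x)K(x,y)$ is locally integrable for every $y>0$ and, for every $y>0$, the limit $\lim_{N\to\infty}\int_0^N f(x)K(x,y)\,dx$ exists and is finite. *)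

(* Defs.v *)
From HB Require Import structures.
From mathcomp Require Import all_boot all_order all_algebra.
From mathcomp Require Import all_classical all_reals all_analysis.

Set Implicit Arguments.
Unset Strict Implicit.
Unset Printing Implicit Defensive.

Import Order.TTheory GRing.Theory Num.Theory.
Import numFieldNormedType.Exports.

Local Open Scope classical_set_scope.
Local Open Scope ring_scope.

(* Functions on (0, +oo) are total functions R -> R used only through their
   values on Rpos.  "Measurable" means Lebesgue measurable: the measure is the
   completed Lebesgue measure, whose sigma-algebra lives on an alias of R. *)

Notation leb R := (@completed_lebesgue_measure R).

Notation lebR R := (caratheodory_type (wlength (@idfun R))^*%mu).

(* The Lebesgue sigma-algebra of the plane: Borel sets up to null sets. *)
Notation leb2R R :=
  (g_sigma_algebraType (measurable_realfun.completed_algebra_gen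
    (@lebesgue_measure R \x @lebesgue_measure R)%E)).

Section Defs.
Context {R : realType}.
Local Notation mu := (leb R).
Implicit Types (A : set R) (f u v s w phi : R -> R) (K : R -> R -> R).

Definition Rpos : set R := `]0, +oo[.

Definition lmeasurable A f := measurable_fun (A : set (lebR R)) (f : lebR R -> R).

Definition kernel_measurable K :=
  measurable_fun (Rpos `*` Rpos : set (leb2R R))
    ((fun z => K z.1 z.2) : leb2R R -> R).

Definition locally_integrable_pos f :=
  lmeasurable Rpos f /\
  forall A, A `<=` Rpos -> compact A -> mu.-integrable A (EFin \o f).

Definition weight u := (forall x : R, 0 < x -> 0 < u x) /\ locally_integrable_pos u.

(* For p = +oo this is the essential supremum of |f| over A. *)
Definition norm_on (p : \bar R) A f : \bar R := 'N[mu]_p[EFin \o (f \_ A)].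

Definition Lp_on (p : \bar R) A f := lmeasurable A f /\ (norm_on p A f < +oo)%E.

Definition wnorm (p : \bar R) v f : \bar R :=
  norm_on p Rpos (fun x => v x * `|f x|).

Definition wLp (p : \bar R) v f := lmeasurable Rpos f /\ (wnorm p v f < +oo)%E.

Definition partial_transform K f (y N : R) : \bar R :=
  (\int[mu]_(x in (`]0%R, N[ : set R)) (f x * K x y)%:E)%E.

(* Finiteness of the limit makes the Lebesgue integrals over (0, N) finite,
   hence f * K(., y) integrable there (+oo - +oo is -oo in \bar R). *)
Definition transform_defined K f :=
  forall y : R, 0 < y ->
    locally_integrable_pos (fun x => f x * K x y) /\
    exists l : R, partial_transform K f y N @[N --> +oo] --> l%:E.

Definition transform K f (y : R) : R :=
  fine (lim (partial_transform K f y N @[N --> +oo])).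

Definition C1_bijection phi :=
  [/\ set_bij Rpos Rpos phi,
      forall x : R, 0 < x -> derivable phi x 1 &
      forall x : R, 0 < x -> {for x, continuous (phi^`()%classic)}].

(* For phi a bijection of Rpos, the image of A under the inverse of phi. *)
Definition inverse_image phi A : set R := Rpos `&` phi @^-1` A.

Definition nonneg_measurable s :=
  lmeasurable Rpos s /\ forall x : R, 0 < x -> 0 <= s x.

End Defs.

(* Main.v *)
Require Import Defs.
From HB Require Import structures.
From mathcomp Require Import all_boot all_order all_algebra.
From mathcomp Require Import all_classical all_reals all_analysis.
From mathcomp Require Import measurable_realfun ess_sup_inf.

Import Order.TTheory GRing.Theory Num.Theory.
Import numFieldNormedType.Exports.

Local Open Scope classical_set_scope.
Local Open Scope ring_scope.

(** Both parts are the classical necessity argument: test the norm inequality on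
    an extremizer of Hoelder's inequality.  Put g = s/v on E and 0 off E, where
    E = (0,r) in part (1) and E = (r,+oo) in part (2), and let Y be the set of y
    with phi(y) > r, respectively phi(y) < r.  In both cases
    K(x,y) >= c s(x) w(y) for all x in E and y in Y, so one statement about E
    and Y ([norm_product_le]) gives both parts.

    By duality of Lebesgue norms there is h >= 0, zero wherever g is, with
    norm_p h <= 1 and norm_p' g <= 2 int g h ([exists_norming]).  For
    1 < p < oo it is the normalized power of g with exponent p' - 1, for p = oo
    the indicator of {g <> 0}; for p = 1, where the supremum defining the dual
    norm need not be attained, it is a normalized indicator of a set of finite
    positive measure where g exceeds half its essential supremum, whence the
    factor 2.

    Take f = h/v.  Then the weighted norm of f is at most 1, and integrating the
    kernel bound against f gives, for y in Y,
      Tf(y) >= c w(y) int f s = c w(y) int g h >= (c/2) w(y) norm_p' g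
    ([transform_ge]).  Multiplying by u, taking L_q norms over Y, and applying
    the assumed inequality yields
      (c/2) norm_p' g * norm_{L_q(Y)} (w u) <= C,
    a bound by 2C/c that does not depend on r. *)

(** * Monotonicity and homogeneity of Lebesgue norms *)

Section Lnorm_facts.
Context {d : measure_display} {T : measurableType d} {R : realType}.
Variable mu : {measure set T -> \bar R}.
Local Open Scope ereal_scope.
Import HBNNSimple.

(** The integral of a nonnegative function is the supremum of the integrals of
    the simple functions below it, so it is monotone over arbitrary functions.
    This is what allows comparing norms with that of the
    transform, whose measurability would be a Fubini-type statement. *)
Lemma le_integral_ge0 (f g : T -> \bar R) :
  (forall x, 0 <= f x) -> (forall x, f x <= g x) ->
  \int[mu]_x f x <= \int[mu]_x g x.
Proof.
move=> f0 fg; rewrite !ge0_integralTE//; last first.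
  by move=> x; rewrite (le_trans (f0 x)).
apply: ereal_sup_le => _ [h hf <-].
by exists h => // x; rewrite (le_trans (hf x)).
Qed.

Lemma le_Lnorm (p : \bar R) (f g : T -> \bar R) : 1 <= p ->
  (forall x, `|f x| <= `|g x|) -> 'N[mu]_p[f] <= 'N[mu]_p[g].
Proof.
rewrite unlock; case: p => [p||//] p1 fg.
  have p0 : (0 <= p)%R by rewrite (le_trans ler01).
  apply: gt0_ler_poweR; rewrite ?invr_ge0// ?in_itv/= ?leey ?integral_ge0//;
    try by move=> x _; exact: poweR_ge0.
  apply: le_integral_ge0 => x; first exact: poweR_ge0.
  by apply: gt0_ler_poweR; rewrite ?in_itv/= ?leey ?abse_ge0.
by case: ifPn => // _; apply: le_ess_sup; apply: nearW => x /=.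
Qed.

Lemma Lnorm_scale (p : \bar R) (k : R) (f : T -> R) : 1 <= p -> (0 <= k)%R ->
  measurable_fun setT f ->
  'N[mu]_p[EFin \o (fun x => k * f x)%R] = k%:E * 'N[mu]_p[EFin \o f].
Proof.
move=> p1; rewrite le_eqVlt => /predU1P[<- _|k0 mf].
  rewrite mul0e -[RHS](@Lnorm0 _ _ _ mu p); last by rewrite gt_eqF ?(lt_le_trans _ p1).
  by apply: eq_Lnorm => x /=; rewrite mul0r.
rewrite unlock; case: p p1 => [p||//] p1; last first.
  case: ifPn => [mu0|]; last by rewrite mule0.
  rewrite -ess_sup_pZl//; congr ess_sup_inf.ess_sup; apply/funext => x /=.
  by rewrite normrM (gtr0_norm k0).
have p0 : (0 < p)%R by rewrite (lt_le_trans ltr01).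
have kp x : (`|(EFin \o (fun x => k * f x)%R) x| `^ p) =
    (k `^ p)%:E * (`|(EFin \o f) x| `^ p).
  by rewrite /= normrM (gtr0_norm k0) -EFinM powRM// ltW.
under eq_integral do rewrite kp.
rewrite ge0_integralZl_EFin//=; last 2 first.
  apply/measurable_EFinP; apply: (measurableT_comp (measurable_powR _)) => //.
  exact: measurableT_comp.
  exact: powR_ge0.
rewrite poweRM ?lee_fin ?powR_ge0//; last first.
  by apply: integral_ge0 => x _; rewrite lee_fin powR_ge0.
by rewrite poweR_EFin -powRrM mulfV ?gt_eqF// powRr1 ?ltW.
Qed.
End Lnorm_facts.

(** * Extremizers for the duality of Lebesgue norms *)

Section dual.
Context {d : measure_display} {T : measurableType d} {R : realType}.
Variable mu : {measure set T -> \bar R}.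
Hypothesis mu_sigma_finite : sigma_finite setT mu.
Local Open Scope ereal_scope.

Lemma sigma_finite_subset (A : set T) : measurable A -> 0 < mu A ->
  exists B, [/\ measurable B, B `<=` A, 0 < mu B & mu B < +oo].
Proof.
move=> mA A0; have [F FT Ffin] := mu_sigma_finite.
apply: contrapT => noB; move: A0; rewrite lt_neqAle => /andP[/eqP + _]; apply.
apply/esym/negligibleP => //.
rewrite -(setIT A) FT setI_bigcupr; apply: negligible_bigcup => k.
have mAF : measurable (A `&` F k) by apply: measurableI => //; case: (Ffin k).
apply/negligibleP => //; apply/eqP; rewrite eq_le measure_ge0 andbT leNgt.
apply/negP => AF0; apply: noB; exists (A `&` F k); split => //.
case: (Ffin k) => mF; apply: le_lt_trans.
by apply: le_measure => //; rewrite inE.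
Qed.

(** [h] is a test function in the unit ball of L_p on which integration against
    [g] attains at least half of the dual norm of [g].  Asking for half only
    makes such an [h] available for p = 1 as well; vanishing where [g] does
    keeps the support of [h] inside that of [g]. *)
Definition norming (p : \bar R) (g h : T -> R) :=
  [/\ measurable_fun setT h, forall x, (0 <= h x)%R,
      forall x, g x = 0%R -> h x = 0%R, 'N[mu]_p[EFin \o h] <= 1 &
      'N[mu]_(hoelder_conjugate p)[EFin \o g] <=
        2%:E * \int[mu]_x (g x * h x)%:E].

Lemma norming_Linfty (g : T -> R) : measurable_fun setT g ->
  (forall x, 0 <= g x)%R -> norming +oo g \1_[set x | g x != 0%R].
Proof.
move=> mg g0; split.
- apply: measurable_indic.
  rewrite (_ : mkset _ = ~` (g @^-1` [set 0%R])).
    by apply: measurableC; rewrite -[X in measurable X]setTI; exact: mg.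
  by apply/seteqP; split => x /= /eqP.
- by move=> x; rewrite indicE.
- by move=> x gx0; rewrite indicE memNset//= gx0 eqxx.
- rewrite unlock; case: ifPn => [_|]; last by rewrite lee01.
  apply/ess_supP; apply: nearW => x /=.
  by rewrite indicE lee_fin; case: (_ \in _); rewrite ?normr1 ?normr0.
- rewrite hoelder_conjugatey Lnorm1.
  have -> : \int[mu]_x `|(EFin \o g) x| =
            \int[mu]_x (g x * \1_[set x | g x != 0%R] x)%:E.
    apply: eq_integral => x _ /=; rewrite ger0_norm// indicE.
    have [gx0|gx0] := eqVneq (g x) 0%R; first by rewrite gx0 mul0r.
    by rewrite mem_set ?mulr1.
  apply: lee_pemull; last by rewrite lee_fin ler1n.
  by apply: integral_ge0 => x _; rewrite lee_fin mulr_ge0// indicE.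
Qed.

(** The set where [g] exceeds half its essential supremum has positive measure;
    on a subset of finite positive measure the average of [g] is at least that
    half. *)
Lemma norming_L1 (g : T -> R) : measurable_fun setT g ->
  (forall x, 0 <= g x)%R -> 'N[mu]_+oo[EFin \o g] < +oo ->
  exists h, norming 1 g h.
Proof.
move=> mg g0 goo; have := Lnorm_ge0 mu +oo (EFin \o g).
rewrite le_eqVlt => /predU1P[G0|].
  exists (cst 0%R); split => //.
    by rewrite (_ : _ \o _ = cst 0)// Lnorm0.
  rewrite hoelder_conjugate1 -G0 mule_ge0//.
  by apply: integral_ge0 => x _; rewrite mulr0.
rewrite /norming hoelder_conjugate1; move: goo.
have -> : 'N[mu]_+oo[EFin \o g] =
    if 0 < mu [set: T] then ess_sup mu (EFin \o g) else 0.
  rewrite unlock; congr (if _ then ess_sup _ _ else _).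
  by apply/funext => x /=; rewrite ger0_norm.
case: ifPn => [mu0|]; last by rewrite ltxx.
case E : (ess_sup _ _) => [G| |]// _; rewrite lte_fin => G0.
set A := (EFin \o g) @^-1` `](G / 2)%:E, +oo[.
have mg' : measurable_fun setT (EFin \o g) by exact/measurable_EFinP.
have mA : measurable A.
  by rewrite -[A]setTI; apply: mg' => //; exact: emeasurable_itv.
have A0 : 0 < mu A.
  rewrite lt_neqAle measure_ge0 andbT; apply/eqP => /esym.
  move=> /(ae_le_measureP mu _ mg') /ess_supP; rewrite E lee_fin leNgt.
  by rewrite ltr_pdivrMr// ltr_pMr// ltr1n.
have [B [mB BA B0 Boo]] := sigma_finite_subset _ mA A0.
have Bfin : mu B \is a fin_num by rewrite ge0_fin_numE.
pose b := fine (mu B).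
have b0 : (0 < b)%R by rewrite fine_gt0// B0.
have muB : mu B = b%:E by rewrite fineK.
exists (fun x => b^-1 * \1_B x)%R; split.
- by apply: measurable_funM => //; exact: measurable_indic.
- by move=> x; rewrite mulr_ge0// ?invr_ge0 ?ltW// indicE.
- move=> x gx0; rewrite indicE memNset ?mulr0// => /BA.
  by rewrite /A /= in_itv /= gx0 lte_fin ltNge divr_ge0// ltW.
- rewrite Lnorm1.
  have -> : \int[mu]_x `|(EFin \o (fun x => b^-1 * \1_B x)%R) x| =
      \int[mu]_x ((b^-1)%:E * (\1_B x)%:E).
    apply: eq_integral => x _ /=.
    by rewrite ger0_norm// mulr_ge0// ?invr_ge0 ?ltW// indicE.
  rewrite ge0_integralZl_EFin ?invr_ge0 ?(ltW b0)//; last first.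
    by apply/measurable_EFinP; exact: measurable_indic.
  by rewrite integral_indic// setIT muB -EFinM mulVf// gt_eqF.
- have : \int[mu]_x ((G / 2 * b^-1)%:E * (\1_B x)%:E) <=
         \int[mu]_x (g x * (b^-1 * \1_B x))%:E.
    apply: le_integral_ge0 => x.
      by rewrite lee_fin !mulr_ge0// ?invr_ge0 ?ltW// indicE.
    rewrite lee_fin indicE; have [/set_mem /BA|_] := boolP (x \in B).
      rewrite /A /= in_itv/= andbT lte_fin => /ltW gx.
      by rewrite !mulr1 ler_wpM2r// invr_ge0 ltW.
    by rewrite !mulr0.
  rewrite ge0_integralZl_EFin//; last 2 first.
    by apply/measurable_EFinP; exact: measurable_indic.
    by rewrite !mulr_ge0// ?invr_ge0 ltW.
  rewrite integral_indic// setIT muB -EFinM divfK ?gt_eqF// => le.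
  rewrite -lee_pdivrMl//; apply: le_trans le.
  by rewrite -EFinM mulrC.
Qed.

(** Equality case of Hoelder's inequality: with b = p' and G the L_b norm of
    [g], if G > 0 take h = (g/G)^(b-1).  As (b-1) p = b, the p-th power of h integrates
    to 1, and int g h = G^(1-b) G^b = G. *)
Lemma norming_Lp (p : R) (g : T -> R) : (1 < p)%R -> measurable_fun setT g ->
  (forall x, 0 <= g x)%R -> 'N[mu]_(hoelder_conjugate p%:E)[EFin \o g] < +oo ->
  exists h, norming p%:E g h.
Proof.
move=> p1 mg g0.
have p0 : (0 < p)%R by rewrite (lt_trans ltr01).
have pm0 : (0 < p - 1)%R by rewrite subr_gt0.
pose b := (p / (p - 1))%R.
have bE : hoelder_conjugate p%:E = b%:E.
  rewrite /hoelder_conjugate/= eqe gt_eqF//.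
  by rewrite -EFinD inver subr_eq0 gt_eqF.
rewrite /norming bE => Goo.
have b0 : (0 < b)%R by rewrite divr_gt0.
have bm : (b - 1 = (p - 1)^-1)%R.
  rewrite /b -[X in (_ - X)%R](@divff _ (p - 1)%R) ?gt_eqF// -mulrBl.
  by rewrite opprB addrC subrK div1r.
have bm0 : (0 < b - 1)%R by rewrite bm invr_gt0.
have := Lnorm_ge0 mu b%:E (EFin \o g).
rewrite le_eqVlt => /predU1P[G0|].
  exists (cst 0%R); split => //.
    by rewrite (_ : _ \o _ = cst 0)// Lnorm0// gt_eqF.
  rewrite -G0 mule_ge0//.
  by apply: integral_ge0 => x _; rewrite mulr0.
have Gb := @poweR_Lnorm _ _ _ mu (EFin \o g) b (lt0r_neq0 b0).
case E : ('N[mu]_b%:E[EFin \o g]) Goo Gb => [G| |]// _ Gb; rewrite lte_fin => G0.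
have Ib : \int[mu]_x (g x `^ b)%:E = (G `^ b)%:E.
  rewrite poweR_EFin in Gb; rewrite Gb; apply: eq_integral => x _ /=.
  by rewrite ger0_norm.
pose k := (G `^ (b - 1))^-1%R.
have k0 : (0 < k)%R by rewrite invr_gt0 powR_gt0.
have mpow (r : R) : measurable_fun setT (fun x => g x `^ r)%R.
  exact: (measurableT_comp (measurable_powR _)).
exists (fun x => k * g x `^ (b - 1))%R; split.
- by apply: measurable_funM.
- by move=> x; rewrite mulr_ge0 ?powR_ge0// ltW.
- by move=> x ->; rewrite powR0 ?mulr0// gt_eqF.
- rewrite Lnorm_scale ?lee_fin ?(ltW p1) ?(ltW k0)//.
  have -> : 'N[mu]_p%:E[EFin \o (fun x => g x `^ (b - 1))%R] = (G `^ (b - 1))%:E.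
    rewrite unlock.
    have -> : \int[mu]_x (`|(EFin \o (fun x => g x `^ (b - 1))%R) x| `^ p) = (G `^ b)%:E.
      rewrite -Ib; apply: eq_integral => x _ /=.
      rewrite ger0_norm ?powR_ge0// -powRrM; congr (_ `^ _)%:E.
      by rewrite bm mulrC.
    rewrite poweR_EFin -powRrM; congr (_ `^ _)%:E.
    by rewrite bm /b mulrAC mulfV ?mul1r// gt_eqF.
  by rewrite -EFinM mulVf// gt_eqF// powR_gt0.
- have -> : \int[mu]_x (g x * (k * g x `^ (b - 1)))%:E =
      \int[mu]_x (k%:E * (g x `^ b)%:E).
    apply: eq_integral => x _; rewrite -EFinM mulrCA; congr (_ * _)%:E.
    rewrite -[X in (X * _)%R](powRr1 (g0 x)) -powRD ?subrKC//.
    by rewrite gt_eqF.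
  rewrite ge0_integralZl_EFin ?(ltW k0)//; last 2 first.
    by move=> x _; rewrite lee_fin powR_ge0.
    exact/measurable_EFinP.
  rewrite Ib -!EFinM lee_fin.
  have -> : (k * G `^ b = G)%R.
    rewrite -[X in (_ `^ X)%R](subrK 1%R) powRD ?subrK ?gt_eqF ?implybT//.
    by rewrite mulrA mulVf ?mul1r ?powRr1 ?ltW// gt_eqF// powR_gt0.
  by rewrite ler_peMl ?ltW// ltr1n.
Qed.

Lemma exists_norming (p : \bar R) (g : T -> R) : 1 <= p ->
  measurable_fun setT g -> (forall x, 0 <= g x)%R ->
  'N[mu]_(hoelder_conjugate p)[EFin \o g] < +oo -> exists h, norming p g h.
Proof.
case: p => [p||//] p1 mg g0.
  move: p1; rewrite lee_fin le_eqVlt => /predU1P[<-|p1].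
    by rewrite hoelder_conjugate1; exact: norming_L1.
  exact: norming_Lp.
by exists (\1_[set x | g x != 0%R]); exact: norming_Linfty.
Qed.
End dual.

(** * Lower bounds for the transform *)

(** On positive reals the inverse is the power function of exponent -1, whose
    measurability is known. *)
Lemma measurable_fun_div (d : measure_display) (T : measurableType d)
    (R : realType) (A : set T) (f v : T -> R) : (forall x, A x -> 0 < v x) ->
  measurable_fun A f -> measurable_fun A v ->
  measurable_fun A (fun x => f x / v x).
Proof.
move=> v0 mf mv.
apply: (@eq_measurable_fun _ _ _ _ A (fun x => f x * v x `^ (-1))).
  by move=> x /set_mem Ax; rewrite powR_inv1// ltW// v0.
apply: measurable_funM => //.
exact: (measurableT_comp (measurable_powR _)).
Qed.

(** The limit defining a transform may be conditional and its integrand signed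
    or non-measurable; what makes the bound pass to the limit is only that the
    lower integrand [k * f] is nonnegative, so that monotone convergence applies
    on that side. *)
Lemma scaled_integral_le_lim (d : measure_display) (T : measurableType d)
    (R : realType) (mu : {measure set T -> \bar R}) (F : (set T)^nat)
    (D : set T) (f g : T -> R) (k a l : R) :
  nondecreasing_seq F -> (forall n, measurable (F n)) -> \bigcup_n F n = D ->
  measurable_fun D f -> (forall x, D x -> 0 <= f x) ->
  (forall x, D x -> k * f x <= g x) -> 0 <= k ->
  (\int[mu]_(x in F n) (g x)%:E)%E @[n --> \oo] --> l%:E ->
  (a%:E <= \int[mu]_(x in D) (f x)%:E)%E -> k * a <= l.
Proof.
move=> ndF mF FD mf f0 fg k0 gl aI.
have FsubD n : F n `<=` D by rewrite -FD => x Fx; exists n.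
have mD : measurable D by rewrite -FD; exact: bigcupT_measurable.
have mfF n : measurable_fun (F n) (EFin \o f).
  by apply/measurable_EFinP; exact: measurable_funS mD (@FsubD n) mf.
have f0F n x : F n x -> (0 <= (f x)%:E)%E by move=> /FsubD /f0; rewrite lee_fin.
have fl : (k%:E * \int[mu]_(x in F n) (f x)%:E)%E @[n --> \oo] -->
          (k%:E * \int[mu]_(x in D) (f x)%:E)%E.
  apply: cvgeZl => //; rewrite -FD.
  exact: ge0_nondecreasing_set_cvg_integral.
rewrite -lee_fin EFinM (le_trans (lee_wpmul2l _ aI)) ?lee_fin//.
apply: (lee_cvg_to fl gl); apply: nearW => n.
rewrite -ge0_integralZl_EFin//; last exact: f0F.
rewrite integral_mkcond [leRHS]integral_mkcond.
apply: le_integral_ge0 => x; rewrite !patchE; case: ifPn => // /set_mem Fx.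
  by rewrite mule_ge0// (f0F n).
by rewrite -EFinM lee_fin fg//; exact: (FsubD n).
Qed.

Section lebesgue.
Context {R : realType}.
Local Notation mu := (leb R).

Lemma Rpos_gt0 (x : R) : Rpos x -> 0 < x.
Proof. by rewrite /Rpos /= in_itv/= andbT. Qed.

(** Measurability on [R] is that of the Borel sets, while the measure lives on
    the larger Lebesgue sigma-algebra. *)
Lemma borel_lebesgue_measurable (A : set R) :
  measurable A -> measurable (A : set (lebR R)).
Proof. exact: sub_caratheodory. Qed.

Lemma lebesgue_measurable_Rpos : measurable (Rpos : set (lebR R)).
Proof. by apply: borel_lebesgue_measurable; exact: measurable_itv. Qed.

(** [phi] is continuous on the open set [Rpos], so the preimage is Borel. *)
Lemma lebesgue_measurable_inverse_image (phi : R -> R) (A : set R) :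
  C1_bijection phi -> measurable A -> measurable (inverse_image phi A : set (lebR R)).
Proof.
move=> [_ dphi _] mA; apply: borel_lebesgue_measurable.
have mphi : measurable_fun Rpos phi; last by apply: mphi => //; exact: measurable_itv.
apply: open_continuous_measurable_fun; first exact: interval_open.
move=> x; rewrite inE /Rpos /= in_itv/= andbT => x0.
by apply: differentiable_continuous; exact/derivable1_diffP/dphi.
Qed.

Lemma bigcup_itv_Rpos : \bigcup_n (`]0%R, n%:R[%classic : set R) = Rpos.
Proof.
apply/seteqP; split => [x [n _] /=|x]; rewrite /Rpos /= !in_itv/= ?andbT.
  by move=> /andP[].
move=> x0; exists (Num.truncn x).+1 => //=.
by rewrite in_itv/= x0 truncnS_gt.
Qed.

(** The lower bound is asked on all of [Rpos]: for [f] supported in a set where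
    the kernel is bounded below, it is trivial off that set because both sides
    vanish. *)
Lemma transform_ge (K : R -> R -> R) (f s : R -> R) (y k a : R) :
  0 < y -> 0 <= k -> lmeasurable Rpos f -> lmeasurable Rpos s ->
  (forall x, 0 < x -> 0 <= f x * s x) ->
  (forall x, 0 < x -> k * (f x * s x) <= f x * K x y) ->
  transform_defined K f ->
  (a%:E <= \int[mu]_(x in Rpos) (f x * s x)%:E)%E ->
  k * a <= transform K f y.
Proof.
move=> y0 k0 mf ms fs0 kfs Kf aI.
have [_ [l fl]] := Kf _ y0.
rewrite /transform (cvg_lim _ fl)//=.
have cl : partial_transform K f y n%:R @[n --> \oo] --> l%:E.
  exact: (cvg_comp _ _ (@cvgr_idn R) fl).
apply: (@scaled_integral_le_lim _ _ _ mu (fun n => `]0%R, n%:R[%classic) Rpos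
  (fun x => f x * s x) (fun x => f x * K x y) k a l _ _ _ _ _ _ k0 cl aI).
- move=> m n mn; apply/subsetPset => x /=; rewrite !in_itv/= => /andP[-> xm]/=.
  by rewrite (lt_le_trans xm)// ler_nat.
- by move=> n; apply: borel_lebesgue_measurable; exact: measurable_itv.
- exact: bigcup_itv_Rpos.
- exact: measurable_funM.
- by move=> x /Rpos_gt0; exact: fs0.
- by move=> x /Rpos_gt0; exact: kfs.
Qed.

(** * The bound for a general pair of sets and the theorem *)

(** The two parts of the theorem are the cases where [E] lies on one side of r
    and [phi] maps [Y] to the other side. *)
Lemma norm_product_le (p q : \bar R) (u v s w : R -> R) (K : R -> R -> R)
    (E Y : set R) (c C : R) :
  (1 <= p)%E -> (1 <= q)%E -> weight u -> weight v ->
  nonneg_measurable s -> nonneg_measurable w -> 0 < c -> 0 < C ->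
  E `<=` Rpos -> measurable (E : set (lebR R)) ->
  Y `<=` Rpos -> measurable (Y : set (lebR R)) ->
  (forall f : R -> R, wLp p v f -> transform_defined K f /\
      (wnorm q u (transform K f) <= C%:E * wnorm p v f)%E) ->
  (forall x y, E x -> Y y -> c * s x * w y <= K x y) ->
  Lp_on (hoelder_conjugate p) E (fun x => s x / v x) ->
  (norm_on q Y (fun y => w y * u y)%R *
   norm_on (hoelder_conjugate p) E (fun x => s x / v x)%R <= (2 / c * C)%:E)%E.
Proof.
move=> p1 q1 [u0 [mu_ _]] [v0 [mv _]] [ms s0] [mw w0] c0 C0 ER mE YR mY hT Ksw.
move=> [msv].
have mRpos := lebesgue_measurable_Rpos.
set g := (fun x => s x / v x) \_ E.
have g0 x : 0 <= g x.
  rewrite /g patchE; case: ifPn => // /set_mem/ER/Rpos_gt0 x0.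
  by rewrite divr_ge0 ?s0// ltW// v0.
have mg : measurable_fun (setT : set (lebR R)) g.
  exact/(measurable_restrictT _ _).1.
rewrite /norm_on -/g => gfin.
have sf : sigma_finite setT mu by exact: sigma_finiteT.
have [h [mh h0 gh hp hg]] := exists_norming mu sf p g p1 mg g0 gfin.
have := Lnorm_ge0 mu (hoelder_conjugate p) (EFin \o g).
case G : ('N[mu]_(hoelder_conjugate p)[EFin \o g])%E gfin hg => [a| |]// _ hg.
rewrite lee_fin => a0.
pose f x := h x / v x.
have mf : lmeasurable Rpos f.
  apply: measurable_fun_div => // [x /Rpos_gt0|]; first exact: v0.
  exact: measurable_funTS.
have f1 : (wnorm p v f <= 1)%E.
  apply: le_trans hp; apply: le_Lnorm => // x /=; rewrite patchE.
  case: ifPn => [/set_mem/Rpos_gt0 x0|_]; last by rewrite normr0 lee_fin.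
  rewrite lee_fin /f normrM normr_id normf_div (ger0_norm (h0 x)).
  by rewrite (gtr0_norm (v0 _ x0)) mulrC divfK// gt_eqF// v0.
have fLp : wLp p v f by split => //; rewrite (le_lt_trans f1)// ltry.
have [Kf Tf] := hT f fLp.
(* f * s = (s / v) * h, and off E both g and h vanish. *)
have IE : (\int[mu]_x (g x * h x)%:E = \int[mu]_(x in Rpos) (f x * s x)%:E)%E.
  rewrite [RHS]integral_mkcond; apply: eq_integral => x _.
  rewrite patchE; case: ifPn => [/set_mem Rx|/negP Rx].
    have [gx0|] := eqVneq (g x) 0.
      by rewrite gx0 /f (gh _ gx0) !mul0r.
    rewrite /g patchE; case: ifPn => [_ _|]; last by rewrite eqxx.
    by congr EFin; rewrite /f mulrC mulrA mulrAC.
  rewrite /g patchE memNset ?mul0r// => /ER Rx'.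
  by apply: Rx; rewrite inE.
have Ty y : Y y -> c * w y * (a / 2) <= transform K f y.
  move=> Yy; have y0 := Rpos_gt0 _ (YR _ Yy).
  apply: (transform_ge K f s) => //.
  - by rewrite mulr_ge0 ?w0// ltW.
  - by move=> x x0; rewrite mulr_ge0 ?s0// divr_ge0// ltW// v0.
  - move=> x x0; have [Ex|Ex] := pselect (E x).
      rewrite mulrCA ler_wpM2l ?divr_ge0 ?(ltW (v0 _ x0))//.
      by rewrite mulrAC Ksw.
    have -> : f x = 0 by rewrite /f gh ?mul0r// /g patchE memNset.
    by rewrite !mul0r mulr0.
  - by rewrite -IE mulrC EFinM lee_pdivrMl.
have mwu : measurable_fun (setT : set (lebR R)) ((fun y => w y * u y) \_ Y).
  apply: (measurable_restrictT _ mY).1.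
  by apply: (measurable_funS mRpos YR); exact: measurable_funM.
have ca0 : 0 <= c * (a / 2) by rewrite mulr_ge0 ?(ltW c0)// divr_ge0.
have key : ((c * (a / 2))%:E * norm_on q Y (fun y => w y * u y)%R <= C%:E)%E.
  rewrite /norm_on -Lnorm_scale//.
  apply: (@le_trans _ _ (wnorm q u (transform K f))); last first.
    by rewrite (le_trans Tf)// -[leRHS]mule1 lee_wpmul2l// lee_fin ltW.
  apply: le_Lnorm => // y /=; rewrite !patchE.
  case: ifPn => [/set_mem Yy|_]; last by rewrite mulr0 normr0 lee_fin.
  have Ry := YR _ Yy; have y0 := Rpos_gt0 _ Ry; have uy := ltW (u0 _ y0).
  rewrite mem_set// lee_fin ger0_norm; last by rewrite (mulr_ge0 ca0)// mulr_ge0// w0.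
  rewrite ger0_norm ?mulr_ge0// mulrA [leRHS]mulrC ler_wpM2r//.
  by rewrite mulrAC (le_trans (Ty _ Yy))// ler_norm.
(* Regrouping avoids dividing by a = norm_p' g, which may be 0 while the other
   norm is +oo. *)
have -> : a%:E = ((2 / c)%:E * (c * (a / 2))%:E)%E.
  by rewrite -EFinM; congr EFin; rewrite [RHS]mulrA divfK ?gt_eqF// mulrC divfK.
by rewrite muleC -muleA [leRHS]EFinM lee_wpmul2l// lee_fin divr_ge0// (ltW c0).
Qed.
End lebesgue.

Theorem theorem4p2 (R : realType) (p q : \bar R) (u v : R -> R)
  (K : R -> R -> R) (phi s1 s2 w1 w2 : R -> R)
  (hp : (1 <= p)%E) (hq : (1 <= q)%E)
  (hu : weight u) (hv : weight v)
  (hK : kernel_measurable K)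
  (hphi : C1_bijection phi)
  (hs1 : nonneg_measurable s1) (hs2 : nonneg_measurable s2)
  (hw1 : nonneg_measurable w1) (hw2 : nonneg_measurable w2)
  (hT : exists2 C : R, 0 < C & forall f : R -> R, wLp p v f ->
      transform_defined K f /\
      (wnorm q u (transform K f) <= C%:E * wnorm p v f)%E) :
  ((exists2 c1 : R, 0 < c1 & forall y : R, 0 < y -> forall x : R, 0 < x < phi y ->
        c1 * s1 x * w1 y <= K x y) ->
   (forall r : R, 0 < r -> Lp_on (hoelder_conjugate p) `]0, r[ (fun x => s1 x / v x)) ->
   (ereal_sup
      [set (norm_on q (inverse_image phi `]r, +oo[) (fun y => w1 y * u y)%R *
            norm_on (hoelder_conjugate p) `]0%R, r[ (fun x => s1 x / v x)%R)%E
      | r in Rpos] < +oo)%E)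
  /\
  ((exists2 c2 : R, 0 < c2 & forall y : R, 0 < y -> forall x : R, phi y < x ->
        c2 * s2 x * w2 y <= K x y) ->
   (forall r : R, 0 < r ->
      Lp_on (hoelder_conjugate p) `]r, +oo[ (fun x => s2 x / v x)) ->
   (ereal_sup
      [set (norm_on q (inverse_image phi `]0%R, r[) (fun y => w2 y * u y)%R *
            norm_on (hoelder_conjugate p) `]r, +oo[ (fun x => s2 x / v x)%R)%E
      | r in Rpos] < +oo)%E).
Proof.
have [C C0 Tbound] := hT.
have inv_sub (A : set R) : inverse_image phi A `<=` Rpos by move=> y [].
split.
- move=> [c c0 Ksw] sv; apply: (@le_lt_trans _ _ (2 / c * C)%:E); last exact: ltry.
  apply: ge_ereal_sup => _ [r /Rpos_gt0 r0 <-].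
  apply: (@norm_product_le R p q u v s1 w1 K) => //.
  + by move=> x; rewrite /Rpos /= !in_itv/= andbT => /andP[].
  + by apply: borel_lebesgue_measurable; exact: measurable_itv.
  + by apply: lebesgue_measurable_inverse_image => //; exact: measurable_itv.
  + move=> x y /=; rewrite in_itv/= => /andP[x0 xr] [/Rpos_gt0 y0].
    rewrite /= in_itv/= andbT => ry.
    by apply: Ksw; rewrite ?x0 ?(lt_trans xr).
  + exact: sv.
- move=> [c c0 Ksw] sv; apply: (@le_lt_trans _ _ (2 / c * C)%:E); last exact: ltry.
  apply: ge_ereal_sup => _ [r /Rpos_gt0 r0 <-].
  apply: (@norm_product_le R p q u v s2 w2 K) => //.
  + move=> x; rewrite /Rpos /= !in_itv/= !andbT; exact: lt_trans.
  + by apply: borel_lebesgue_measurable; exact: measurable_itv.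
  + by apply: lebesgue_measurable_inverse_image => //; exact: measurable_itv.
  + move=> x y /=; rewrite in_itv/= andbT => rx [/Rpos_gt0 y0].
    rewrite /= in_itv/= => /andP[_ yr].
    by apply: Ksw => //; exact: lt_trans rx.
  + exact: sv.
Qed.
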